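(* Let $A\in\mathbb{K}^{n\times n}$, let $\mathcal{X}_a$ be a subspace of $\mathbb{K}^n$ of dimension $p$, and let $X_a\in\mathbb{K}^{n\times p}$ be a full rank matrix with $\mathfrak{R}(X_a)=\mathcal{X}_a$. Then the matrices $\Delta A\in\mathbb{K}^{n\times n}$ such that $\mathcal{X}_a$ is an invariant subspace of $A+\Delta A$ are exactly those of the form $$\Delta A=(X_a\Lambda_a-AX_a)X_a^{\dagger}+Z(I_n-X_aX_a^{\dagger})$$ for some $\Lambda_a\in\mathbb{K}^{p\times p}$, where $Z\in\mathbb{K}^{n\times n}$ is arbitrary.
   Context: $\mathbb{K}\in\{\mathbb{R},\mathbb{C}\}$. $X^\dagger$ is the Moore-Penrose pseudoinverse of $X$, $\mathfrak{R}(X)$ is the column space of $X$, and $I_n$ is the identity matrix of order $n$. A subspace $\mathcal{X}$ is invariant for a matrix $M$ if $M\mathcal{X}\subseteq\mathcal{X}$. *)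

(* Defs.v *)
From HB Require Import structures.
From mathcomp Require Import all_boot all_order all_algebra.
From mathcomp Require Import complex reals.

Set Implicit Arguments.
Unset Strict Implicit.
Unset Printing Implicit Defensive.

Import Order.TTheory GRing.Theory Num.Theory.
Local Open Scope ring_scope.

(* [scalar_field R k] is K in {R, C}; quantifying over [k] covers both cases. *)
Variant scalar_kind := RealScalars | ComplexScalars.

Definition scalar_field (R : realType) (k : scalar_kind) : numFieldType :=
  match k with
  | RealScalars => R : numFieldType
  | ComplexScalars => R[i] : numFieldType
  end.

Definition sconj (R : realType) (k : scalar_kind) : scalar_field R k -> scalar_field R k :=
  match k return scalar_field R k -> scalar_field R k with
  | RealScalars => id
  | ComplexScalars => @conjc R
  end.

Definition adjmx (R : realType) (k : scalar_kind) (m n : nat)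
    (X : 'M[scalar_field R k]_(m, n)) : 'M[scalar_field R k]_(n, m) :=
  (map_mx (@sconj R k) X)^T.

(* The four Penrose equations. *)
Definition is_mp_inverse (R : realType) (k : scalar_kind) (m n : nat)
    (X : 'M[scalar_field R k]_(m, n)) (Y : 'M[scalar_field R k]_(n, m)) : bool :=
  [&& X *m Y *m X == X,
      Y *m X *m Y == Y,
      adjmx (X *m Y) == X *m Y
    & adjmx (Y *m X) == Y *m X].

Section PenroseTheory.
Variables (R : realType) (k : scalar_kind).
Local Notation K := (scalar_field R k).

Lemma sconj_zmod : zmod_morphism (@sconj R k).
Proof. by case: k => //= x y; rewrite rmorphB. Qed.

Lemma sconj_monoid : monoid_morphism (@sconj R k).
Proof. by case: k => //=; split=> [|x y]; rewrite ?rmorph1 ?rmorphM. Qed.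

HB.instance Definition _ := GRing.isZmodMorphism.Build K K (@sconj R k) sconj_zmod.
HB.instance Definition _ := GRing.isMonoidMorphism.Build K K (@sconj R k) sconj_monoid.

Lemma sconjK : involutive (@sconj R k).
Proof. by case: k => //= x; rewrite conjcK. Qed.

Lemma sconj_mul_ge0 (x : K) : 0 <= sconj x * x.
Proof.
case: k x => /= x; first by rewrite -expr2 sqr_ge0.
by rewrite mulrC; apply: mul_conjC_ge0.
Qed.

Lemma adjmxK m n (X : 'M[K]_(m, n)) : adjmx (adjmx X) = X.
Proof. by apply/matrixP=> i j; rewrite !mxE sconjK. Qed.

Lemma adjmxM m n p (X : 'M[K]_(m, n)) (Y : 'M[K]_(n, p)) :
  adjmx (X *m Y) = adjmx Y *m adjmx X.
Proof. by rewrite /adjmx map_mxM trmx_mul. Qed.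

Lemma adjmx_mul_eq0 m n (X : 'M[K]_(m, n)) : adjmx X *m X = 0 -> X = 0.
Proof.
move=> X0; apply/matrixP=> i j; rewrite mxE.
have /eqP := congr1 (fun M : 'M_n => M j j) X0.
rewrite !mxE psumr_eq0; last by move=> l _; rewrite !mxE sconj_mul_ge0.
by move/allP/(_ i (mem_index_enum _)); rewrite !mxE mulf_eq0 fmorph_eq0 orbb => /eqP.
Qed.

Lemma adjmx_mul_unit m n (X : 'M[K]_(m, n)) :
  row_full X -> adjmx X *m X \in unitmx.
Proof.
move=> Xfull; rewrite -row_free_unit -kermx_eq0.
set u := kermx _; have uG : u *m (adjmx X *m X) = 0 by exact: mulmx_ker.
have Xu0 : X *m adjmx u = 0.
  by apply: adjmx_mul_eq0; rewrite adjmxM adjmxK -mulmxA [X in _ *m X]mulmxA mulmxA uG mul0mx.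
have u0 : adjmx u = 0 by apply: (row_full_inj Xfull); rewrite Xu0 mulmx0.
by rewrite -[u]adjmxK u0 /adjmx map_mx0 trmx0.
Qed.

Lemma adjmx_inv n (X : 'M[K]_n) : adjmx X = X -> adjmx (invmx X) = invmx X.
Proof. by move=> sX; rewrite /adjmx map_invmx trmx_inv -[in RHS]sX. Qed.

Lemma mp_inverse_factor m n r (C : 'M[K]_(m, r)) (D : 'M[K]_(r, n)) :
  row_full C -> row_free D -> exists Y, is_mp_inverse (C *m D) Y.
Proof.
move=> Cfull Dfree; pose G := adjmx C *m C; pose H := D *m adjmx D.
have Gu : G \in unitmx by rewrite adjmx_mul_unit.
have Hu : H \in unitmx.
  rewrite /H -[X in X *m _]adjmxK adjmx_mul_unit //.
  by rewrite /row_full mxrank_tr mxrank_map.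
have Gs : adjmx (invmx G) = invmx G by rewrite adjmx_inv // adjmxM adjmxK.
have Hs : adjmx (invmx H) = invmx H by rewrite adjmx_inv // adjmxM adjmxK.
pose Y := adjmx D *m invmx H *m (invmx G *m adjmx C).
have XY : C *m D *m Y = C *m invmx G *m adjmx C.
  by rewrite /Y !mulmxA -(mulmxA C D) -/H -(mulmxA C H) mulmxV // mulmx1.
have YX : Y *m (C *m D) = adjmx D *m invmx H *m D.
  rewrite /Y -!mulmxA (mulmxA (adjmx C)) -/G.
  by rewrite (mulmxA (invmx G)) mulVmx // mul1mx.
exists Y; apply/and4P; split; apply/eqP.
- by rewrite XY mulmxA -(mulmxA _ (adjmx C)) -/G mulmxKV.
- rewrite YX {1}/Y !mulmxA -(mulmxA _ D) -/H mulmxKV //.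
  by rewrite /Y !mulmxA.
- by rewrite XY !adjmxM adjmxK Gs mulmxA.
- by rewrite YX !adjmxM adjmxK Hs mulmxA.
Qed.

Lemma mp_inverse_exists m n (X : 'M[K]_(m, n)) : exists Y, is_mp_inverse X Y.
Proof.
rewrite -(mulmx_base X).
by apply: mp_inverse_factor; rewrite ?col_base_full ?row_base_free.
Qed.

Lemma mp_inverse_unique m n (X : 'M[K]_(m, n)) Y Z :
  is_mp_inverse X Y -> is_mp_inverse X Z -> Y = Z.
Proof.
case/and4P=> /eqP Y1 /eqP Y2 /eqP Y3 /eqP Y4.
case/and4P=> /eqP Z1 /eqP Z2 /eqP Z3 /eqP Z4.
have XYZ : X *m Y = X *m Z.
  by rewrite -Y3 -{1}Z1 -(mulmxA (X *m Z)) adjmxM Y3 Z3 mulmxA Y1.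
have YZX : Y *m X = Z *m X.
  by rewrite -Y4 -{1}Z1 -(mulmxA X) mulmxA adjmxM Y4 Z4 -mulmxA (mulmxA X) Y1.
by rewrite -Y2 YZX -mulmxA XYZ mulmxA Z2.
Qed.

Definition mp_inverse m n (X : 'M[K]_(m, n)) : 'M[K]_(n, m) :=
  xchoose (mp_inverse_exists X).

Lemma mp_inverseP m n (X : 'M[K]_(m, n)) : is_mp_inverse X (mp_inverse X).
Proof. exact: xchooseP. Qed.

End PenroseTheory.

Definition full_rank (F : fieldType) (m n : nat) (X : 'M[F]_(m, n)) : bool :=
  \rank X == minn m n.

Definition colspace (F : fieldType) (m n : nat) (X : 'M[F]_(m, n)) :
    {vspace 'cV[F]_m} :=
  <<[seq col j X | j : 'I_n]>>%VS.

Definition invariant_subspace (F : fieldType) (n : nat) (M : 'M[F]_n)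
    (V : {vspace 'cV[F]_n}) : bool :=
  (linfun (mulmx M) @: V <= V)%VS.

(* Main.v *)
Require Import Defs.
From mathcomp Require Import all_boot all_order all_algebra.
From mathcomp Require Import complex reals.

(** Invariance of the column space of [X] under [M = A + DA] means [M X = X L]
    for some [L].  As [X] has full column rank, [X^+ X = 1], so the solutions of
    the linear equation [DA X = X L - A X] are the particular solution
    [(X L - A X) X^+] plus any matrix killing [X], i.e. any [Z (1 - X X^+)]. *)

Import GRing.Theory.

Local Open Scope ring_scope.

Section ColumnSpace.
Variables (F : fieldType) (m n : nat).
Implicit Types X : 'M[F]_(m, n).

(** Both sides describe the image of [mulmx X]: it contains every column of [X], and [X *m c]
    combines the columns with coefficients [c]. *)
Lemma memv_colspaceP X (v : 'cV[F]_m) :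
  reflect (exists c, v = X *m c) (v \in colspace X).
Proof.
have -> : colspace X = limg (linfun (mulmx X : 'cV[F]_n -> 'cV[F]_m)).
  apply/eqP; rewrite eqEsubv; apply/andP; split.
    apply/span_subvP=> _ /mapP[j _ ->].
    by rewrite colE -(lfunE (mulmx X)) memv_img ?memvf.
  apply/subvP=> _ /memv_imgP[c _ ->]; rewrite lfunE /=.
  have -> : X *m c = \sum_j c j ord0 *: col j X.
    apply/colP=> i; rewrite mxE summxE.
    by apply: eq_bigr => j _; rewrite !mxE mulrC.
  apply: memv_suml => j _; apply: memvZ; apply: memv_span.
  by apply: map_f; rewrite mem_enum.
apply: (iffP memv_imgP) => [[c _ ->]|[c ->]]; exists c; rewrite ?memvf ?lfunE //.
Qed.

Lemma invariant_colspaceP X (M : 'M[F]_m) :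
  invariant_subspace M (colspace X) <-> exists L, M *m X = X *m L.
Proof.
split=> [/subvP invX | [L MX]].
  (* [submxP] factors through row spaces, hence the transposes; rows of [X^T] are columns of [X]. *)
  suff /submxP[L MX] : ((M *m X)^T <= X^T)%MS.
    by exists L^T; apply: trmx_inj; rewrite [RHS]trmx_mul trmxK.
  apply/row_subP=> j; rewrite -tr_col.
  have Xj : col j X \in colspace X.
    by apply/memv_colspaceP; exists (delta_mx j ord0); rewrite colE.
  have /memv_colspaceP[c] := invX _ (memv_img (linfun (mulmx M)) Xj).
  rewrite lfunE /= colE mulmxA -colE => ->.
  by rewrite trmx_mul submxMl.
apply/subvP=> _ /memv_imgP[v /memv_colspaceP[c ->] ->].
by apply/memv_colspaceP; exists (L *m c); rewrite lfunE /= !mulmxA MX.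
Qed.

End ColumnSpace.

(** Full column rank makes [X] left-cancellable in the Penrose equation [X X^+ X = X]. *)
Lemma mulVmp (R : realType) (k : scalar_kind) (n p : nat)
    (X : 'M[scalar_field R k]_(n, p)) :
  row_full X -> mp_inverse X *m X = 1%:M.
Proof.
move=> Xfull; apply: (row_full_inj Xfull).
by have /and4P[/eqP XYX _ _ _] := mp_inverseP X; rewrite mulmxA XYX mulmx1.
Qed.

Theorem proposition2p1 (R : realType) (k : scalar_kind) (n p : nat)
    (A : 'M[scalar_field R k]_n) (V : {vspace 'cV[scalar_field R k]_n}) (dimV : \dim V = p)
    (X : 'M[scalar_field R k]_(n, p)) (fullX : full_rank X) (colX : colspace X = V)
    (DA : 'M[scalar_field R k]_n) :
  invariant_subspace (A + DA) V <->
  exists (L : 'M[scalar_field R k]_p) (Z : 'M[scalar_field R k]_n),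
    DA = (X *m L - A *m X) *m mp_inverse X
         + Z *m (1%:M - X *m mp_inverse X).
Proof.
(* With [p <= n], full rank means full column rank. *)
have le_pn : (p <= n)%N.
  by rewrite -dimV (leq_trans (dimvS (subvf V))) // dimvf /dim /= muln1.
have YX : mp_inverse X *m X = 1%:M.
  by apply: mulVmp; rewrite /row_full (eqP fullX) (minn_idPr le_pn).
rewrite -colX; apply: (iff_trans (invariant_colspaceP _ _ _ _ _)).
split=> [[L MX] | [L [Z ->]]]; exists L.
  (* [Z = DA] works: the first term becomes [DA X X^+], which the second completes to [DA]. *)
  exists DA; rewrite -MX [(A + DA) *m X]mulmxDl addrAC subrr add0r.
  by rewrite mulmxBr mulmx1 mulmxA addrCA subrr addr0.
(* Multiplied by [X] on the right, the [Z] term vanishes and [A X] cancels, leaving [X L]. *)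
rewrite (mulmxDl A) (mulmxDl (_ *m mp_inverse X)) -2!mulmxA (mulmxBl 1%:M) mul1mx.
by rewrite -(mulmxA X) YX !mulmx1 subrr mulmx0 addr0 addrCA subrr addr0.
Qed.
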